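(* Let $y,w\in\mathbf{I}_*$ be such that $y\le w$. The constant term of $P^\sigma_{y,w}\in\mathbf{Z}[u]$ is equal to $1$.
   Context: $W$ is a Coxeter group with set of simple reflections $S$, length function $l:W\to\mathbf{N}$ and Bruhat order $\le$. $w\mapsto w^*$ is an automorphism of $W$ with square $1$ which leaves $S$ stable. $\mathbf{I}_*=\{w\in W : (w^* )^{-1}=w\}$. $u$ is an indeterminate and $\mathcal{A}=\mathbf{Z}[u,u^{-1}]$. $\mathfrak{H}$ is the free $\mathcal{A}$-module with basis $(T_w)_{w\in W}$ with the unique $\mathcal{A}$-algebra structure with unit $T_1$ such that $T_wT_{w'}=T_{ww'}$ if $l(ww')=l(w)+l(w')$, and $(T_s+1)(T_s-u^2)=0$ for all $s\in S$. $\overline{\phantom{x}}:\mathfrak{H}\to\mathfrak{H}$ is the unique ring involution such that $\overline{u^nT_x}=u^{-n}T_{x^{-1}}^{-1}$ for $x\in W$, $n\in\mathbf{Z}$. $M$ is the free $\mathcal{A}$-module with basis $\{a_w : w\in\mathbf{I}_*\}$, with its unique $\mathfrak{H}$-module structure such that for $s\in S$, $w\in\mathbf{I}_*$: $T_s a_w = u a_w + (u+1)a_{sw}$ if $sw = ws^* > w$; $T_s a_w = (u^2-u-1)a_w + (u^2-u)a_{sw}$ if $sw = ws^* < w$; $T_s a_w = a_{sws^*}$ if $sw\ne ws^*$, $sw > w$; $T_s a_w = (u^2-1)a_w + u^2 a_{sws^*}$ if $sw\ne ws^*$, $sw < w$. $\overline{\phantom{x}}:M\to M$ is the unique $\mathbf{Z}$-linear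 map such that $\overline{hm}=\overline{h}\,\overline{m}$ for $h\in\mathfrak{H}$, $m\in M$ and $\overline{a_1}=a_1$. $v$ is an indeterminate, $\underline{\mathcal{A}}=\mathbf{Z}[v,v^{-1}]\supset\mathcal{A}$ via $u=v^2$. $\underline{M}=\underline{\mathcal{A}}\otimes_{\mathcal{A}}M$, and $\overline{\phantom{x}}$ is extended to $\underline{M}$ by $\overline{v^nm}=v^{-n}\overline{m}$ for $m\in M$, $n\in\mathbf{Z}$. For $w\in\mathbf{I}_*$, $A_w=v^{-l(w)}\sum_{y\in\mathbf{I}_*;\,y\le w}P^\sigma_{y,w}a_y\in\underline{M}$ (with $P^\sigma_{y,w}\in\mathbf{Z}[u]$) is the unique element of this form such that $\overline{A_w}=A_w$, $P^\sigma_{w,w}=1$ and $\deg P^\sigma_{y,w}\le(l(w)-l(y)-1)/2$ for all $y\in\mathbf{I}_*$, $y<w$. This defines the polynomials $P^\sigma_{y,w}$. *)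

(* Defs.v *)
From HB Require Import structures.
From mathcomp Require Import all_boot all_algebra.
From mathcomp Require Import boolp classical_sets fsbigop.

Set Implicit Arguments.
Unset Strict Implicit.
Unset Printing Implicit Defensive.

Import GRing.Theory.
Local Open Scope ring_scope.

(* [laurent k] is the subring Z[v^k, v^-k] of the field of fractions of Z[v],
   so that [laurent 2] = Z[u, u^-1], with u = v^2, is included in
   [laurent 1] = Z[v, v^-1]. *)
Section Laurent.
Variable k : nat.

Local Notation "x %:F" := (@FracField.tofrac _ x).

Definition laurent_pred : {pred {fraction {poly int}}} := fun x =>
  `[< exists (p : {poly int}) (n : nat),
      x = (p \Po 'X^k)%:F / ('X^k)%:F ^+ n >].

Let Xk_neq0 n : ('X^k)%:F ^+ n != 0 :> {fraction {poly int}}.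
Proof. by rewrite expf_neq0 // tofrac_eq0 monic_neq0 // monicXn. Qed.

Let comp_Xk n : 'X^n \Po 'X^k = 'X^k ^+ n :> {poly int}.
Proof. by rewrite comp_Xn_poly. Qed.

Fact laurent_subring : subring_closed laurent_pred.
Proof.
split.
- apply/asboolP; exists 1, 0%N.
  by rewrite comp_polyC expr0 divr1 tofrac1.
- move=> _ _ /asboolP[p [n ->]] /asboolP[q [m ->]]; apply/asboolP.
  exists (p * 'X^m - q * 'X^n), (n + m)%N.
  rewrite comp_polyB !comp_polyM !comp_Xk tofracB !tofracM.
  rewrite (tofracXn m) (tofracXn n) exprD -[in RHS]mulNr -addf_div ?Xk_neq0 //.
  by rewrite mulNr.
- move=> _ _ /asboolP[p [n ->]] /asboolP[q [m ->]]; apply/asboolP.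
  exists (p * q), (n + m)%N.
  by rewrite comp_polyM tofracM exprD invfM mulrACA.
Qed.

HB.instance Definition _ :=
  GRing.isSubringClosed.Build {fraction {poly int}} laurent_pred laurent_subring.

Record laurent := Laurent {
  laurent_val :> {fraction {poly int}};
  laurent_valP : laurent_val \in laurent_pred }.

HB.instance Definition _ := [isSub for laurent_val].
HB.instance Definition _ := [Choice of laurent by <:].
HB.instance Definition _ := [SubChoice_isSubComNzRing of laurent by <:].

Definition laurent_unit : {pred laurent} := fun x =>
  (val x != 0) && ((val x)^-1 \in laurent_pred).
Definition laurent_inv (x : laurent) : laurent := insubd x (val x)^-1.

Fact laurent_mulVr : {in laurent_unit, left_inverse 1 laurent_inv *%R}.
Proof.
move=> x /andP[x0 xV]; apply/val_inj.
by rewrite rmorphM rmorph1 /= /laurent_inv val_insubd xV mulVf.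
Qed.

Fact laurent_unitPl (x y : laurent) : y * x = 1 -> laurent_unit x.
Proof.
move=> /(congr1 val); rewrite rmorphM rmorph1 /= => yx.
have x0 : val x != 0 by apply: contra_eq_neq yx => ->; rewrite mulr0 eq_sym oner_neq0.
apply/andP; split=> //.
suff -> : (val x)^-1 = val y by exact: valP.
by rewrite -[LHS]mul1r -yx mulfK.
Qed.

Fact laurent_inv_out : {in [predC laurent_unit], laurent_inv =1 id}.
Proof.
move=> x; rewrite inE /= negb_and negbK => /orP[/eqP x0|xV].
  by apply/val_inj; rewrite /laurent_inv val_insubd x0 invr0 if_same.
by apply/val_inj; rewrite /laurent_inv val_insubd (negbTE xV).
Qed.

HB.instance Definition _ := GRing.ComNzRing_hasMulInverse.Build laurent
  laurent_mulVr laurent_unitPl laurent_inv_out.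

Fact laurent_genP : ('X^k)%:F \in laurent_pred.
Proof.
apply/asboolP; exists 'X, 0%N.
by rewrite comp_polyX expr0 divr1.
Qed.

Definition laurent_gen : laurent := Laurent laurent_genP.

End Laurent.

Fact laurent_sub21 (x : laurent 2) : laurent_val x \in laurent_pred 1.
Proof.
case: x => x /= /asboolP[p [n ->]]; apply/asboolP.
exists (p \Po 'X^2), n.*2.
by rewrite -comp_polyA comp_Xn_poly expr1 tofracXn -mul2n exprM.
Qed.

Notation Zu := (laurent 2).
Notation Zv := (laurent 1).
Definition u : Zu := laurent_gen 2.
Definition v : Zv := laurent_gen 1.

Definition Zu_Zv (x : Zu) : Zv := Laurent (laurent_sub21 x).

Section Coxeter.
Variables (W : groupType) (S : {pred W}).
Local Open Scope group_scope.

(* Bourbaki, Lie IV.1.3: the last field says that W is presented by the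
   generators S and the relations (s t)^m = 1, with m the order of s t.
   Quantifying over all n with (s t)^n = 1 amounts to taking n = m. *)
Record coxeter_system : Prop := CoxeterSystem {
  coxeter_gen : forall w : W,
    exists2 r : seq W, all [in S] r & w = \prod_(s <- r) s;
  coxeter_neq1 : forall s, s \in S -> s != 1;
  coxeter_sq : forall s, s \in S -> s * s = 1;
  coxeter_pres : forall (G : groupType) (f : W -> G),
    (forall s t n, s \in S -> t \in S ->
       (s * t) ^+ n = 1 -> (f s * f t) ^+ n = 1) ->
    exists g : {multiplicative W -> G}, {in S, g =1 f} }.

Definition has_word (w : W) (n : nat) : Prop :=
  exists r : seq W, [/\ size r = n, all [in S] r & w = \prod_(s <- r) s].

Definition cox_length (w : W) : nat :=
  xget 0%N [set n | has_word w n /\ forall m, has_word w m -> (n <= m)%N].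

Definition reflection (t : W) : Prop :=
  exists x s, s \in S /\ t = x * s * x^-1.

Inductive bruhat (x : W) : W -> Prop :=
| bruhat_refl : bruhat x x
| bruhat_step y t : bruhat x y -> reflection t ->
    (cox_length y < cox_length (t * y))%N -> bruhat x (t * y).

Definition bruhat_lt (x y : W) : Prop := bruhat x y /\ x <> y.

Record coxeter_involution (star : W -> W) : Prop := CoxeterInvolution {
  cox_star_inv : involutive star;
  cox_star_simple : forall s, s \in S -> star s \in S }.

End Coxeter.

(* [b] restricted to [D] is a basis for the scalar action [sc] of [R] on [V]. *)
Record is_basis (R : nzRingType) (V : zmodType) (sc : R -> V -> V)
    (K : choiceType) (D : {pred K}) (b : K -> V) : Prop := IsBasis {
  basis_span : forall x : V, exists (r : seq K) (c : K -> R),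
    all [in D] r /\ x = \sum_(k <- r) sc (c k) (b k);
  basis_indep : forall (r : seq K) (c : K -> R), uniq r -> all [in D] r ->
    \sum_(k <- r) sc (c k) (b k) = 0 -> {in r, forall k, c k = 0} }.

Section Hecke.
Variables (W : groupType) (S : {pred W}) (H : unitAlgType Zu).
Local Notation l := (cox_length S).

Record hecke_algebra (T : W -> H) : Prop := HeckeAlgebra {
  hecke_basis : is_basis (fun (c : Zu) (h : H) => c *: h) predT T;
  hecke_T1 : T 1%g = 1;
  hecke_TM : forall x y : W, l (x * y)%g = (l x + l y)%N ->
    T x * T y = T (x * y)%g;
  hecke_quad : forall s, s \in S -> (T s + 1) * (T s - (u ^+ 2)%:A) = 0 }.

Record hecke_bar (T : W -> H) (barH : H -> H) : Prop := HeckeBar {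
  hecke_bar_inv : involutive barH;
  hecke_barE : forall (n : int) (x : W),
    barH (u ^ n *: T x) = u ^ (- n) *: (T x^-1%g)^-1 }.

End Hecke.

Section InvolutionModule.
Variables (W : groupType) (S : {pred W}) (star : W -> W).
Variables (H : unitAlgType Zu) (T : W -> H) (M : lmodType H).

Definition Istar : {pred W} := [pred w | (star w)^-1%g == w].

(* Only the values of [a] on [Istar] are meaningful. *)
Record involution_module (a : W -> M) : Prop := InvolutionModule {
  inv_basis : is_basis (fun (c : Zu) (m : M) => c%:A *: m) Istar a;
  inv_comm_gt : forall s w, s \in S -> w \in Istar ->
    (s * w)%g = (w * star s)%g -> bruhat_lt S w (s * w)%g ->
    T s *: a w = u%:A *: a w + (u + 1)%:A *: a (s * w)%g;
  inv_comm_lt : forall s w, s \in S -> w \in Istar ->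
    (s * w)%g = (w * star s)%g -> bruhat_lt S (s * w)%g w ->
    T s *: a w = (u ^+ 2 - u - 1)%:A *: a w + (u ^+ 2 - u)%:A *: a (s * w)%g;
  inv_ncomm_gt : forall s w, s \in S -> w \in Istar ->
    (s * w)%g <> (w * star s)%g -> bruhat_lt S w (s * w)%g ->
    T s *: a w = a (s * w * star s)%g;
  inv_ncomm_lt : forall s w, s \in S -> w \in Istar ->
    (s * w)%g <> (w * star s)%g -> bruhat_lt S (s * w)%g w ->
    T s *: a w = (u ^+ 2 - 1)%:A *: a w + (u ^+ 2)%:A *: a (s * w * star s)%g }.

Record involution_bar (barH : H -> H) (a : W -> M) (barM : M -> M) : Prop :=
  InvolutionBar {
  inv_barZ : forall (h : H) (m : M), barM (h *: m) = barH h *: barM m;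
  inv_bar1 : barM (a 1%g) = a 1%g }.

Variables (vM : lmodType Zv) (iota : {additive M -> vM}).

(* Universal property of [iota m] = 1 (x) m, characterizing the tensor product
   of Zv and M over Zu. *)
Record scalar_extension : Prop := ScalarExtension {
  ext_semilinear : forall (c : Zu) (m : M),
    iota (c%:A *: m) = Zu_Zv c *: iota m;
  ext_universal : forall (N : lmodType Zv) (f : {additive M -> N}),
    (forall (c : Zu) (m : M), f (c%:A *: m) = Zu_Zv c *: f m) ->
    exists g : {linear vM -> N}, (forall m, g (iota m) = f m) /\
      forall g' : {linear vM -> N}, (forall m, g' (iota m) = f m) -> g' =1 g }.

Definition extended_bar (barM : M -> M) (barvM : vM -> vM) : Prop :=
  forall (n : int) (m : M), barvM (v ^ n *: iota m) = v ^ (- n) *: iota (barM m).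

(* [\sum_(y \in D)] is 0 when the support in D is infinite, but Bruhat lower
   intervals are finite, even if S is infinite. *)
Definition KL_elt (a : W -> M) (P : W -> W -> {poly int}) (w : W) : vM :=
  v ^ (- (cox_length S w)%:Z) *:
  \sum_(y \in [set y | y \in Istar /\ bruhat S y w])
    (map_poly intr (P y w)).[Zu_Zv u] *: iota (a y).

(* As y < w implies l(y) < l(w), the degree bound also allows P y w = 0. *)
Record KL_polynomials (a : W -> M) (barvM : vM -> vM)
    (P : W -> W -> {poly int}) : Prop := KLPolynomials {
  KL_bar : forall w, w \in Istar -> barvM (KL_elt a P w) = KL_elt a P w;
  KL_diag : forall w, w \in Istar -> P w w = 1;
  KL_deg : forall y w, y \in Istar -> w \in Istar -> bruhat_lt S y w ->
    ((size (P y w)).-1.*2 + cox_length S y < cox_length S w)%N }.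

End InvolutionModule.

(* Main.v *)
(* Write [bar a_x = \sum_y c_{y,x} a_y].  Comparing the coefficients of [a_y] in
   [bar A_w = A_w], and using the degree bound on the P_{x,w}, every x < w
   contributes to P_{y,w} only multiples of positive powers of v, provided that
   u^l(x) c_{y,x} is regular at v = 0.  Hence the constant term of P_{y,w} is the
   value of u^l(w) c_{y,w} at v = 0, and it suffices to show that u^l(w) bar a_w
   tends to the sum of the a_y over y <= w in I_*.  This follows by induction on
   l(w): if w = s.w' is obtained from a shorter w' in I_* by twisted conjugation,
   then at u = 0 the element for w is (T_s + 1) times the element for w'; since
   T_s + 1 then sends a_y to a_y + a_{s.y} if sy > y and to 0 if sy < y, the
   lifting property of the Bruhat order on I_* identifies the result.  The needed facts on Coxeter
   groups (strong exchange, lifting) come from the inversion cocycle, which the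
   presentation of W provides. *)
Require Import Defs.
From HB Require Import structures.
From mathcomp Require Import all_boot all_algebra.
From mathcomp Require Import ring zify.
From mathcomp Require Import boolp classical_sets cardinality fsbigop.

Set Implicit Arguments.
Unset Strict Implicit.
Unset Printing Implicit Defensive.

Import GRing.Theory.
Local Open Scope ring_scope.

Section Multiplicative.
Variables (G G' : groupType) (f : {multiplicative G -> G'}).
Local Open Scope group_scope.

Lemma multiplicative1 : f 1 = 1.
Proof. by apply: (mulgI (f 1)); rewrite -gmulfM !mulg1. Qed.

End Multiplicative.

(** * The group extension that carries the inversion cocycle *)

Section InversionCocycle.
Variable W : groupType.
Local Open Scope group_scope.

(* The semidirect product of [W] with the functions [W -> bool], on which [W]
   acts by conjugation: morphisms to it lifting the identity are 1-cocycles. *)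
Definition inv_ext : Type := (W * (W -> bool))%type.

HB.instance Definition _ := gen_eqMixin inv_ext.
HB.instance Definition _ := gen_choiceMixin inv_ext.

Definition inv_ext_mul (x y : inv_ext) : inv_ext :=
  (x.1 * y.1, fun t => x.2 t (+) y.2 (t ^ x.1)).
Definition inv_ext_one : inv_ext := (1, fun=> false).
Definition inv_ext_inv (x : inv_ext) : inv_ext :=
  (x.1^-1, fun t => x.2 (t ^ x.1^-1)).

Fact inv_ext_mulA : associative inv_ext_mul.
Proof.
move=> [x X] [y Y] [z Z]; congr pair => /=; first by rewrite mulgA.
by apply/funext => t; rewrite /= addbA conjgM.
Qed.

Fact inv_ext_mul1 : left_id inv_ext_one inv_ext_mul.
Proof.
move=> [x X]; congr pair => /=; first by rewrite mul1g.
by apply/funext => t; rewrite conjg1.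
Qed.

Fact inv_ext_1mul : right_id inv_ext_one inv_ext_mul.
Proof.
move=> [x X]; congr pair => /=; first by rewrite mulg1.
by apply/funext => t; rewrite addbF.
Qed.

Fact inv_ext_mulV : left_inverse inv_ext_one inv_ext_inv inv_ext_mul.
Proof.
move=> [x X]; congr pair => /=; first by rewrite mulVg.
by apply/funext => t; rewrite addbb.
Qed.

Fact inv_ext_Vmul : right_inverse inv_ext_one inv_ext_inv inv_ext_mul.
Proof.
move=> [x X]; congr pair => /=; first by rewrite mulgV.
by apply/funext => t; rewrite conjgK addbb.
Qed.

HB.instance Definition _ := isGroup.Build inv_ext
  inv_ext_mulA inv_ext_mul1 inv_ext_1mul inv_ext_mulV inv_ext_Vmul.

(** A simple [s] inverts only the reflection [s], so the cocycle at [s] is prescribed to be the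
    indicator of [s]. *)
Definition inv_ext_gen (s : W) : inv_ext := (s, fun t => t == s).
End InversionCocycle.

(** * Length, reflections and strong exchange *)

Section Length.
Variables (W : groupType) (S : {pred W}) (coxW : coxeter_system S).
Local Open Scope group_scope.
Local Notation l := (cox_length S).

Lemma cox_invg s : s \in S -> s^-1 = s.
Proof. by move=> sS; apply: mulg1_eq; apply: coxeter_sq coxW _ sS. Qed.

Lemma cox_mulK s x : s \in S -> s * (s * x) = x.
Proof. by move=> sS; rewrite mulgA (coxeter_sq coxW sS) mul1g. Qed.

Lemma cox_mulrK s x : s \in S -> x * s * s = x.
Proof. by move=> sS; rewrite -mulgA (coxeter_sq coxW sS) mulg1. Qed.

(** Each letter of the word [s t s t ...] contributes its conjugate by the prefix before it. As [s]
    conjugates [rho] to its inverse, these conjugates are the reflections [rho ^+ j * s]. *)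
Lemma inv_ext_gen_pow s t n (rho := s * t) : s \in S -> t \in S ->
  (inv_ext_gen s * inv_ext_gen t) ^+ n =
  (rho ^+ n, fun r => \big[addb/false]_(j < n.*2) (r == rho ^+ j * s)).
Proof.
move=> sS tS.
have sV : s^-1 = s by exact: cox_invg.
have tV : t^-1 = t by exact: cox_invg.
have rhoV k : s * rho ^- k = rho ^+ k * s.
  elim: k => [|k IH]; first by rewrite !expg0 invg1 mulg1 mul1g.
  rewrite [in LHS]expgS invgM mulgA IH -mulgA expgSr -mulgA.
  by rewrite /rho invgM sV tV -[s * t * s]mulgA.
elim: n => [|n IH].
  by rewrite !expg0; congr pair; apply/funext => r; rewrite big_ord0.
rewrite expgSr IH; congr pair; first by rewrite /= -expgSr.
apply/funext => r; rewrite /= doubleS !big_ord_recr /= -addbA.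
have conj_eq (x y z : W) : (x ^ y == z) = (x == z ^ y^-1).
  by rewrite (can2_eq (conjgK y) (conjgKV y)).
congr (_ (+) (_ (+) _)); rewrite !conj_eq.
  by rewrite conjgE invgK rhoV mulgA -expgnDr addnn.
congr (_ == _); rewrite !conjgE !invgK sV [s * (t * s)]mulgA -/rho -[rho * s * _]mulgA rhoV.
by rewrite [rho * _]mulgA -expgS mulgA -expgnDr addnS addnn.
Qed.

(** The generators [inv_ext_gen s] satisfy the Coxeter relations, so the presentation gives a
    morphism to [inv_ext]. It lifts the identity because it does so on [S], and its second component
    is the cocycle. *)
Lemma inversion_cocycle_ex : exists N : W -> W -> bool,
  (forall x y t, N (x * y) t = N x t (+) N y (t ^ x)) /\
  {in S, forall s, N s =1 pred1 s}.
Proof.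
have [s t n sS tS st1|g gE] := coxeter_pres coxW (f := @inv_ext_gen W).
  (* Since [(s * t) ^+ n = 1], the indices [j] and [n + j] give the same reflection, and the
     contributions cancel in pairs. *)
  rewrite inv_ext_gen_pow // st1; congr pair; apply/funext => r.
  rewrite -addnn big_split_ord /= -big_split big1 // => j _.
  by rewrite /= expgnDr st1 mul1g addbb.
have g1 w : (g w).1 = w.
  have [r rS ->] := coxeter_gen coxW w.
  elim: r rS => [|s r IH] /=; first by rewrite big_nil multiplicative1.
  by case/andP=> sS rS; rewrite big_cons gmulfM /= IH // gE.
exists (fun w => (g w).2); split=> [x y t|s sS t]; last by rewrite gE.
by rewrite gmulfM /= g1.
Qed.

Lemma cox_lengthP w : has_word S w (l w) /\ forall m, has_word S w m -> (l w <= m)%N.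
Proof.
(* A word for [w] exists because [S] generates, hence so does one of minimal size, and the default
   value 0 of [xget] is never taken. *)
rewrite /cox_length; case: xgetP => [n -> //|nex]; exfalso.
have ex : exists n, `[< has_word S w n >].
  by have [r rS ->] := coxeter_gen coxW w; exists (size r); apply/asboolP; exists r.
case: (ex_minnP ex) => n /asboolP nP min; apply: (nex n); split=> // m mP.
by apply: min; apply/asboolP.
Qed.

Lemma reduced_word w : exists r, [/\ size r = l w, all [in S] r & w = \prod_(s <- r) s].
Proof. by have [] := cox_lengthP w. Qed.

Lemma cox_length_word r : all [in S] r -> (l (\prod_(s <- r) s) <= size r)%N.
Proof. by move=> rS; apply: (cox_lengthP _).2; exists r. Qed.

Lemma cox_length1 : l 1 = 0%N.
Proof. by apply/eqP; rewrite -leqn0; have := @cox_length_word [::] isT; rewrite big_nil. Qed.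

Lemma cox_lengthV w : l w^-1 = l w.
Proof.
suff le x : (l x^-1 <= l x)%N by apply/eqP; rewrite eqn_leq le -{1}[w]invgK le.
have [r [<- rS ->]] := reduced_word x; rewrite -(revK r) -prodgV size_rev.
rewrite big_seq (eq_bigr id) => [|s sr]; last first.
  by apply: cox_invg; move/allP: rS; apply; rewrite -mem_rev.
by rewrite -big_seq cox_length_word // all_rev.
Qed.

Lemma cox_lengthM_le x y : (l (x * y) <= l x + l y)%N.
Proof.
have [r [<- rS ->]] := reduced_word x; have [q [<- qS ->]] := reduced_word y.
by rewrite -big_cat -size_cat cox_length_word // all_cat rS.
Qed.

Lemma cox_length_gen_le s : s \in S -> (l s <= 1)%N.
Proof. by move=> sS; have := @cox_length_word [:: s]; rewrite big_seq1 /= sS; apply. Qed.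

Lemma reflectionP t : reflection S t -> exists2 s, s \in S & exists x, t = s ^ x.
Proof. by case=> x [s [sS ->]]; exists s => //; exists x^-1; rewrite conjgE invgK mulgA. Qed.

Lemma reflectionJ t x : reflection S t -> reflection S (t ^ x).
Proof.
by move=> [y [s [sS ->]]]; exists (x^-1 * y), s; rewrite conjgE invgM invgK !mulgA.
Qed.

Lemma reflection_gen s : s \in S -> reflection S s.
Proof. by move=> sS; exists 1, s; rewrite invg1 mulg1 mul1g. Qed.

Lemma reflection_sq t : reflection S t -> t * t = 1.
Proof.
by case/reflectionP=> s sS [x ->]; rewrite -conjMg (coxeter_sq coxW sS) conj1g.
Qed.

Definition inversion (w t : W) : bool := (l (t * w) < l w)%N.

(* If the cocycle of a product of simple reflections is [true] at [t], then [t]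
   comes from one of the letters, and deleting that letter gives a word for [t * w]. *)
Lemma inversion_spec t : reflection S t ->
  [/\ forall w, (l w < l (t * w))%N = ~~ inversion w t,
      forall x y, inversion (x * y) t = inversion x t (+) inversion y (t ^ x)
    & {in S, forall s, inversion s t = (t == s)}].
Proof.
have [N [NM NS]] := inversion_cocycle_ex.
have N1 r : N 1 r = false.
  by have := NM 1 1 r; rewrite mul1g conjg1; case: (N 1 r).
have Ninv w r : N w r -> inversion w r.
  have [q [lq qS w_q]] := reduced_word w => Nwr; rewrite /inversion -lq.
  suff [q' [q'S lq' ->]] :
      exists q', [/\ all [in S] q', (size q' < size q)%N & r * w = \prod_(s <- q') s].
    exact: leq_ltn_trans (cox_length_word q'S) lq'.
  rewrite w_q in Nwr *; elim: q qS r Nwr {w w_q lq} => [|s q IH] /=.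
    by move=> _ r; rewrite big_nil N1.
  case/andP=> sS qS r; rewrite big_cons NM NS //=.
  case: eqP => [-> _|_ Nr]; first by exists q; rewrite cox_mulK.
  have [q' [q'S lq' rE]] := IH qS _ Nr; exists (s :: q').
  by rewrite /= sS big_cons -rE conjgE cox_invg // !mulgA (coxeter_sq coxW sS) mul1g.
(* For [r = x^-1 * s * x] the contributions of [x^-1] and [x] cancel, because [N 1] vanishes. What
   is left is [N s s], which is true. *)
have Nrefl r : reflection S r -> N r r.
  case/reflectionP=> s sS [x ->]; rewrite [in N _]conjgE.
  have := NM x^-1 x (s ^ x); rewrite mulVg N1 !NM conjgK (NS _ sS) (_ : s ^ s = s) /= ?eqxx; last by rewrite conjgE mulKg.
  by case: (N x^-1 _); case: (N x s).
move=> tR; have tV := reflection_sq tR.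
(* If [N w r] is false, then [N (r * w) r] is true by [Nrefl], so [r] shortens [r * w] to [w] and
   cannot shorten [w]. *)
have NinvE r w : reflection S r -> inversion w r = N w r.
  move=> rR; case Nw : (N w r); first exact: Ninv.
  have /Ninv : N (r * w) r by rewrite NM Nrefl //= conjgE mulKg Nw.
  rewrite /inversion mulgA reflection_sq // mul1g => lt.
  by apply/negbTE; rewrite -leqNgt ltnW.
split=> [w|x y|s sS]; last by rewrite NinvE // NS.
  apply/idP/idP => [|ninv]; first by rewrite /inversion -leqNgt => /ltnW.
  have /Ninv : N (t * w) t by rewrite NM Nrefl //= conjgE mulKg -NinvE // (negbTE ninv).
  by rewrite /inversion mulgA tV mul1g.
by rewrite !NinvE ?NM //; apply: reflectionJ.
Qed.
End Length.

(** * Bruhat order: lifting property and finiteness of lower intervals *)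

Section Bruhat.
Variables (W : groupType) (S : {pred W}) (coxW : coxeter_system S).
Local Open Scope group_scope.
Local Notation l := (cox_length S).
Local Notation "x <=B y" := (bruhat S x y) (at level 70).

Lemma cox_length_gt t w : reflection S t -> (l w < l (t * w))%N = ~~ (l (t * w) < l w)%N.
Proof. by move=> tR; have [-> _ _] := inversion_spec coxW tR. Qed.

Lemma cox_length_mul_le s w : s \in S -> (l (s * w) <= (l w).+1)%N.
Proof.
move=> sS; apply: leq_trans (cox_lengthM_le coxW s w) _.
by rewrite -add1n leq_add2r cox_length_gen_le.
Qed.

Lemma cox_length_up s w : s \in S -> ~~ (l (s * w) < l w)%N -> l (s * w) = (l w).+1.
Proof.
move=> sS; rewrite -cox_length_gt; last exact: reflection_gen.
by move=> lt; apply/eqP; rewrite eqn_leq cox_length_mul_le.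
Qed.

Lemma cox_length_down s w : s \in S -> (l (s * w) < l w)%N -> l w = (l (s * w)).+1.
Proof.
move=> sS lt; rewrite -[in LHS](cox_mulK coxW w sS) cox_length_up //.
by rewrite (cox_mulK coxW) // -leqNgt ltnW.
Qed.

Lemma left_descent_ex w : w <> 1 -> exists2 s, s \in S & (l (s * w) < l w)%N.
Proof.
have [[|s r] [lr rS wr]] := reduced_word coxW w; first by rewrite wr big_nil.
move=> _; case/andP: rS => sS rS; exists s => //.
by rewrite -lr wr big_cons (cox_mulK coxW) // ltnS cox_length_word.
Qed.

(** By the cocycle identity the two descent conditions differ only if [s ^ w] is an inversion of
    [t], that is, if [s ^ w = t]. *)
Lemma cox_length_mul_lr s t w : s \in S -> t \in S -> s * w <> w * t ->
  (l (s * (w * t)) < l (w * t))%N = (l (s * w) < l w)%N.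
Proof.
move=> sS tS nst; have [_ NM _] := inversion_spec coxW (reflection_gen sS).
have [_ _ NS] := inversion_spec coxW (reflectionJ w (reflection_gen sS)).
have := NM w t; rewrite NS // /inversion => ->.
case: eqP => [swt|]; last by rewrite addbF.
by case: nst; rewrite -swt conjgE mulVKg.
Qed.

Lemma bruhat_trans x y z : x <=B y -> y <=B z -> x <=B z.
Proof. by move=> xy; elim=> // {}z t _ IH tR lt; apply: bruhat_step. Qed.

Lemma bruhat_length x y : x <=B y -> x = y \/ (l x < l y)%N.
Proof.
elim=> [|{}y t _ [->|IH] _ lt]; [by left | by right | right].
exact: ltn_trans lt.
Qed.

Lemma bruhat1 x : x <=B 1 -> x = 1.
Proof. by case/bruhat_length => //; rewrite cox_length1. Qed.

(** The inverse of [t * y] is [y^-1] multiplied on the left by the reflection [t ^ y]. This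
    transports the left-handed lifting statements to right multiplication. *)
Lemma bruhatV x y : x <=B y -> x^-1 <=B y^-1.
Proof.
elim=> [|{}y t _ IH tR lt]; first exact: bruhat_refl.
have tV : t^-1 = t by apply: mulg1_eq; apply: reflection_sq tR.
have E : (t * y)^-1 = t ^ y * y^-1 by rewrite conjgE invgM tV mulgA mulgK.
rewrite E; apply: bruhat_step => //; first exact: reflectionJ.
by rewrite -E !(cox_lengthV coxW).
Qed.

Lemma bruhat_mul_up s w : s \in S -> ~~ (l (s * w) < l w)%N -> bruhat_lt S w (s * w).
Proof.
move=> sS ndn; have lsw := cox_length_up sS ndn; split.
  by apply: bruhat_step; [apply: bruhat_refl|apply: reflection_gen|rewrite lsw].
by move=> /(congr1 l)/eqP; rewrite lsw ltn_eqF.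
Qed.

Lemma bruhat_mul_down s w : s \in S -> (l (s * w) < l w)%N -> bruhat_lt S (s * w) w.
Proof.
move=> sS dn; rewrite -{2}(cox_mulK coxW w sS); apply: bruhat_mul_up => //.
by rewrite (cox_mulK coxW) // -leqNgt ltnW.
Qed.

(** The step becomes left multiplication by [t ^ s]. By the cocycle identity it still goes up,
    because [t ^ s] differs from [s] and so is not an inversion of [s]. *)
Lemma bruhat_cover_mul s t y : s \in S -> reflection S t -> t <> s ->
  (l y < l (t * y))%N -> s * y <=B s * (t * y).
Proof.
move=> sS tR ts lt.
have -> : s * (t * y) = t ^ s * (s * y).
  by rewrite conjgE (cox_invg coxW) // !mulgA (cox_mulrK coxW).
have tsR := reflectionJ s tR; apply: (bruhat_step (bruhat_refl _ _) tsR).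
have [-> NM NS] := inversion_spec coxW tsR.
have ss (x : W) : (x ^ s) ^ s = x by rewrite -conjgM (coxeter_sq coxW sS) conjg1.
rewrite NM NS // ss /inversion [(l _ < _)%N]ltnNge ltnW // addbF.
by apply/eqP => /(congr1 (conjg^~ s)); rewrite ss conjgE mulKg.
Qed.

(** Lifting in a form free of descent conditions: multiplication by [s] preserves every step of a
    chain except those by [s] itself, which produce the other alternative. The same induction gives
    [bruhat_lift]. *)
Lemma bruhat_lift_mul s x y : s \in S -> x <=B y -> s * x <=B y \/ s * x <=B s * y.
Proof.
move=> sS; elim=> [|{}y t xy IH tR lt]; first by right; apply: bruhat_refl.
have yty : y <=B t * y by apply: (bruhat_step (bruhat_refl _ _) tR lt).
case: IH => IH; first by left; apply: bruhat_trans yty.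
have [->|/eqP ts] := eqVneq t s; [by left | right].
exact: (bruhat_trans IH (bruhat_cover_mul sS tR ts lt)).
Qed.

Lemma bruhat_lift s x y : s \in S -> x <=B y -> x <=B s * y \/ s * x <=B s * y.
Proof.
move=> sS; elim=> [|{}y t xy IH tR lt]; first by right; apply: bruhat_refl.
have [->|/eqP ts] := eqVneq t s; first by left; rewrite (cox_mulK coxW).
have le := bruhat_cover_mul sS tR ts lt.
by case: IH => IH; [left | right]; apply: bruhat_trans le.
Qed.

Lemma bruhat_mul_closed s x w : s \in S -> (l (s * w) < l w)%N -> x <=B w -> s * x <=B w.
Proof.
move=> sS dn xw; have [sww _] := bruhat_mul_down sS dn.
by case: (bruhat_lift_mul sS xw) => // /bruhat_trans; apply.
Qed.

Lemma bruhat_lift_up s x w : s \in S -> ~~ (l (s * x) < l x)%N -> x <=B w -> x <=B s * w.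
Proof.
move=> sS up xw; have [xsx _] := bruhat_mul_up sS up.
by case: (bruhat_lift sS xw) => //; apply: bruhat_trans.
Qed.

Lemma bruhat_mulr_closed t x w : t \in S -> (l (w * t) < l w)%N -> x <=B w -> x * t <=B w.
Proof.
move=> tS dn /bruhatV xw; rewrite -[x * t]invgK -[w]invgK; apply: bruhatV.
rewrite invgM (cox_invg coxW tS); apply: bruhat_mul_closed xw => //.
by rewrite -{1}(cox_invg coxW tS) -invgM !(cox_lengthV coxW).
Qed.

Lemma bruhat_liftr_up t x w : t \in S -> ~~ (l (x * t) < l x)%N -> x <=B w -> x <=B w * t.
Proof.
move=> tS up /bruhatV xw; rewrite -[w * t]invgK -[x]invgK; apply: bruhatV.
rewrite invgM (cox_invg coxW tS); apply: bruhat_lift_up xw => //.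
by rewrite -{1}(cox_invg coxW tS) -invgM !(cox_lengthV coxW).
Qed.

(** For a left descent [s] of [w], lifting covers the interval below [w] by the one below [s * w]
    and its translate by [s]. *)
Lemma finite_bruhat w : finite_set [set x | x <=B w].
Proof.
have [n] := ubnP (l w); elim: n w => // n IH w /ltnSE lw.
have [->|/eqP w1] := eqVneq w 1.
  by apply: sub_finite_set (finite_set1 1) => x /bruhat1.
have [s sS dn] := left_descent_ex w1.
have fin := IH (s * w) (leq_trans dn lw).
apply: (@sub_finite_set _ _ ([set x | x <=B s * w] `|` [set s * x | x in [set x | x <=B s * w]])%classic).
  move=> x /= xw; case: (bruhat_lift sS xw) => h; [by left | right].
  by exists (s * x) => //; rewrite (cox_mulK coxW).
by rewrite finite_setU; split=> //; apply: finite_image.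
Qed.
End Bruhat.

(** * Twisted conjugation on the twisted involutions, and its compatibility with Bruhat order *)

Section TwistedInvolutions.
Variables (W : groupType) (S : {pred W}) (coxW : coxeter_system S).
Variables (star : {multiplicative W -> W}) (coxstar : coxeter_involution S star).
Local Open Scope group_scope.
Local Notation l := (cox_length S).
Local Notation "x <=B y" := (bruhat S x y) (at level 70).

Lemma IstarP w : reflect (star w = w^-1) (w \in Istar star).
Proof. by rewrite inE -(inj_eq (@invg_inj W)) invgK; apply: eqP. Qed.

Lemma Istar1 : 1 \in Istar star.
Proof. by apply/IstarP; rewrite multiplicative1 invg1. Qed.

Lemma cox_length_star w : l (star w) = l w.
Proof.
suff le x : (l (star x) <= l x)%N.
  by apply/eqP; rewrite eqn_leq le -{1}(cox_star_inv coxstar w) le.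
have [r [<- rS ->]] := reduced_word coxW x.
have -> : star (\prod_(s <- r) s) = \prod_(s <- map star r) s.
  rewrite big_map; elim: r {rS} => [|s r IH]; first by rewrite !big_nil multiplicative1.
  by rewrite !big_cons gmulfM IH.
rewrite -(size_map star r) cox_length_word // all_map.
by apply/allP => s sr /=; apply/(cox_star_simple coxstar)/(allP rS).
Qed.

(* The index occurring besides [w] in [T s *: a w]. *)
Definition twisted (s w : W) : W :=
  if s * w == w * star s then s * w else s * w * star s.

Variable s : W.
Hypothesis sS : s \in S.

Let tS : star s \in S. Proof. exact: (cox_star_simple coxstar). Qed.

(** The inverse of [star (s * w)] is [w * star s], and both operations preserve length. Left
    descents of [w] thus become right descents. *)
Lemma cox_length_Istar_mulr w : w \in Istar star -> l (w * star s) = l (s * w).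
Proof.
move=> /IstarP wI; rewrite -(cox_length_star (s * w)) gmulfM wI.
by rewrite -[RHS](cox_lengthV coxW) invgM invgK (cox_invg coxW tS).
Qed.

Lemma twisted_comm w :
  (s * twisted s w == twisted s w * star s) = (s * w == w * star s).
Proof.
rewrite {1 2}/twisted; case: (eqVneq (s * w) (w * star s)) => [e|ne].
  by rewrite (cox_mulK coxW) // e (cox_mulrK coxW) ?eqxx.
by rewrite (cox_mulrK coxW) // -[s * w * _]mulgA (cox_mulK coxW) // eq_sym; apply/negbTE.
Qed.

Lemma twistedK : involutive (twisted s).
Proof.
move=> w; rewrite {1}/twisted twisted_comm /twisted; case: (eqVneq (s * w) (w * star s)) => [e|ne].
  by rewrite (cox_mulK coxW).
by rewrite !mulgA (coxeter_sq coxW sS) mul1g (cox_mulrK coxW).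
Qed.

Lemma twisted_Istar w : w \in Istar star -> twisted s w \in Istar star.
Proof.
move=> /IstarP wI; apply/IstarP.
have sV := cox_invg coxW sS; have tV := cox_invg coxW tS.
rewrite /twisted; case: (eqVneq (s * w) (w * star s)) => [e|ne].
  by rewrite gmulfM wI e invgM tV.
by rewrite !gmulfM wI (cox_star_inv coxstar) !invgM sV tV mulgA.
Qed.

Lemma twisted_descent w : w \in Istar star ->
  (l (s * twisted s w) < l (twisted s w))%N = ~~ (l (s * w) < l w)%N.
Proof.
move=> wI; rewrite /twisted; case: ifPn => [/eqP e|/eqP ne].
  by rewrite (cox_mulK coxW) // (cox_length_gt coxW) //; apply: reflection_gen.
rewrite -mulgA (cox_mulK coxW) // (cox_length_gt coxW); last exact: reflection_gen.
by rewrite (cox_length_mul_lr coxW).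
Qed.

Lemma twisted_length w : w \in Istar star -> (l (s * w) < l w)%N ->
  l w = (l (twisted s w) + (if (s * w == w * star s)%g then 1 else 2))%N.
Proof.
move=> wI dn; rewrite (cox_length_down coxW sS dn) /twisted.
case: ifPn => [/eqP e|/eqP ne]; first by rewrite addn1.
rewrite addn2 -mulgA -(cox_length_Istar_mulr wI); congr _.+1.
by rewrite [LHS](cox_length_down coxW sS) // (cox_length_mul_lr coxW).
Qed.

Lemma bruhat_twisted x w : w \in Istar star -> (l (s * w) < l w)%N ->
  x <=B w -> twisted s x <=B w.
Proof.
move=> wI dn xw; have sxw := bruhat_mul_closed coxW sS dn xw.
rewrite /twisted; case: ifP => // _.
by apply: bruhat_mulr_closed sxw; rewrite ?cox_length_Istar_mulr.
Qed.

Lemma bruhat_twisted_up x w : x \in Istar star -> ~~ (l (s * x) < l x)%N ->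
  x <=B w -> x <=B twisted s w.
Proof.
move=> xI up xw; have xsw := bruhat_lift_up coxW sS up xw.
rewrite /twisted; case: ifP => // _.
by apply: bruhat_liftr_up xsw; rewrite ?cox_length_Istar_mulr.
Qed.

(** This is the recursion for the indicator of the lower interval of [w]: only the lower of [x] and
    [twisted s x] has to be compared with [twisted s w]. *)
Lemma bruhat_twistedE x w : x \in Istar star -> w \in Istar star ->
  (l (s * w) < l w)%N ->
  x <=B w <-> (if (l (s * x) < l x)%N then twisted s x else x) <=B twisted s w.
Proof.
move=> xI wI dn.
have w1w : twisted s w <=B w by apply: bruhat_twisted => //; apply: bruhat_refl.
case: ifPn => [dnx|upx]; split=> [xw|].
- apply: bruhat_twisted_up; rewrite ?twisted_Istar ?twisted_descent ?dnx //.
  apply: bruhat_trans xw; apply: bruhat_twisted => //; exact: bruhat_refl.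
- by move=> /bruhat_trans/(_ w1w)/(bruhat_twisted wI dn); rewrite twistedK.
- exact: bruhat_twisted_up.
- by move=> /bruhat_trans; apply.
Qed.
End TwistedInvolutions.

(** * Rational functions in [v] that are regular at 0, and their values there *)

Section LocalRingAtZero.
Local Notation "x %:F" := (@FracField.tofrac _ x).

(* [f] is regular at [v = 0] with value [c]; requiring [q.[0] = 1] rather than
   [q.[0] != 0] makes the value an integer. *)
Definition at0 (f : {fraction {poly int}}) (c : int) : Prop :=
  exists p q : {poly int}, [/\ p.[0] = c, q.[0] = 1 & f * q%:F = p%:F].

Lemma at0_poly (p : {poly int}) : at0 p%:F p.[0].
Proof. by exists p, 1; rewrite hornerC tofrac1 mulr1. Qed.

Lemma at0D f g c d : at0 f c -> at0 g d -> at0 (f + g) (c + d).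
Proof.
move=> [p [q [<- q1 fE]]] [p' [q' [<- q'1 gE]]].
exists (p * q' + p' * q), (q * q'); rewrite !hornerE q1 q'1 !mulr1; split=> //.
by rewrite tofracD !tofracM mulrDl mulrA fE [q%:F * _]mulrC [g * _]mulrA gE.
Qed.

Lemma at0M f g c d : at0 f c -> at0 g d -> at0 (f * g) (c * d).
Proof.
move=> [p [q [<- q1 fE]]] [p' [q' [<- q'1 gE]]].
exists (p * p'), (q * q'); rewrite !hornerE q1 q'1 !mulr1; split=> //.
by rewrite !tofracM mulrACA fE gE.
Qed.

Lemma at0_int n : at0 n%:~R n.
Proof.
by have := at0_poly n%:P; rewrite hornerC -{1}[n]intz !rmorph_int.
Qed.

Lemma at0N f c : at0 f c -> at0 (- f) (- c).
Proof. by move=> /(at0M (at0_int (-1))); rewrite rmorphN1 !mulN1r. Qed.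

Lemma at0B f g c d : at0 f c -> at0 g d -> at0 (f - g) (c - d).
Proof. by move=> fc /at0N; apply: at0D. Qed.

Lemma at0X f c n : at0 f c -> at0 (f ^+ n) (c ^+ n).
Proof.
move=> fc; elim: n => [|n IH]; first exact: (at0_int 1).
by rewrite !exprS; apply: at0M.
Qed.

Lemma at0_sum (I : eqType) (r : seq I) (Q : pred I) (F : I -> {fraction {poly int}}) G :
  (forall i, i \in r -> Q i -> at0 (F i) (G i)) ->
  at0 (\sum_(i <- r | Q i) F i) (\sum_(i <- r | Q i) G i).
Proof.
move=> FG; rewrite big_seq_cond [X in at0 _ X]big_seq_cond.
apply: (big_ind2 at0) => [|f c g d fc gd|i /andP[]]; last exact: FG.
  exact: (at0_int 0).
exact: at0D.
Qed.

Lemma at0_inj f c d : at0 f c -> at0 f d -> c = d.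
Proof.
move=> [p [q [<- q1 fE]]] [p' [q' [<- q'1 gE]]].
have /eqP : (p * q')%:F = (p' * q)%:F by rewrite !tofracM -fE -gE mulrAC.
by rewrite tofrac_eq => /eqP/(congr1 (horner^~ 0)); rewrite !hornerE q1 q'1 !mulr1.
Qed.

(** A numerator with value 1 at 0 may serve as a denominator. This allows division by [1 + u], which
    is not a unit among the Laurent polynomials. *)
Lemma at0_cancel f g c : at0 f 1 -> at0 (f * g) c -> at0 g c.
Proof.
move=> [p [q [p1 q1 fE]]] [p' [q' [<- q'1 gE]]].
exists (p' * q), (p * q'); rewrite !hornerE p1 q1 q'1 !mulr1; split=> //.
by rewrite !tofracM -fE -gE mulrC [LHS]mulrAC -[_ * q%:F * g]mulrA (mulrC q%:F) mulrA [LHS]mulrAC.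
Qed.

(** Values are taken in the common fraction field, so that passing from [Zu] to [Zv] does not affect
    them. *)
Definition lat0 k (x : laurent k) (c : int) : Prop := at0 (val x) c.

Section LaurentAtZero.
Variable k : nat.
Implicit Types (x y : laurent k) (c d : int).

Lemma lat0D x y c d : lat0 x c -> lat0 y d -> lat0 (x + y) (c + d).
Proof. by rewrite /lat0 rmorphD; apply: at0D. Qed.

Lemma lat0M x y c d : lat0 x c -> lat0 y d -> lat0 (x * y) (c * d).
Proof. by rewrite /lat0 rmorphM; apply: at0M. Qed.

Lemma lat0B x y c d : lat0 x c -> lat0 y d -> lat0 (x - y) (c - d).
Proof. by rewrite /lat0 rmorphB; apply: at0B. Qed.

Lemma lat0_int n : lat0 (n%:~R : laurent k) n.
Proof. by rewrite /lat0 rmorph_int; apply: at0_int. Qed.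

Lemma lat00 : lat0 (0 : laurent k) 0. Proof. exact: (lat0_int 0). Qed.
Lemma lat01 : lat0 (1 : laurent k) 1. Proof. exact: (lat0_int 1). Qed.

Lemma lat0X x c n : lat0 x c -> lat0 (x ^+ n) (c ^+ n).
Proof. by rewrite /lat0 rmorphXn; apply: at0X. Qed.

Lemma lat0_sum (I : eqType) (r : seq I) (Q : pred I) (F : I -> laurent k) G :
  (forall i, i \in r -> Q i -> lat0 (F i) (G i)) ->
  lat0 (\sum_(i <- r | Q i) F i) (\sum_(i <- r | Q i) G i).
Proof. by rewrite /lat0 rmorph_sum; apply: at0_sum. Qed.

Lemma lat0_inj x c d : lat0 x c -> lat0 x d -> c = d.
Proof. exact: at0_inj. Qed.

Lemma lat0_cancel x y c : lat0 x 1 -> lat0 (x * y) c -> lat0 y c.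
Proof. by rewrite /lat0 rmorphM; apply: at0_cancel. Qed.

Lemma laurent_gen_unit : laurent_gen k \is a GRing.unit.
Proof.
have X0 : ('X^k)%:F != 0 :> {fraction {poly int}} by rewrite tofrac_eq0 monic_neq0 ?monicXn.
apply/andP; split; first exact: X0.
apply/asboolP; exists 1, 1%N.
by rewrite comp_polyC tofrac1 div1r expr1.
Qed.

Lemma lat0_gen : (0 < k)%N -> lat0 (laurent_gen k) 0.
Proof. by move=> k0; have := at0_poly 'X^k; rewrite hornerXn expr0n gtn_eqF. Qed.
End LaurentAtZero.

Lemma Zu_Zv_u : Zu_Zv u = v ^+ 2.
Proof. by apply/val_inj; rewrite rmorphXn /= expr1 tofracXn. Qed.
End LocalRingAtZero.

(** * Coordinates with respect to a basis *)

Section Coordinates.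
Variables (K : comNzRingType) (H : algType K) (M : lmodType H).
Variables (I : choiceType) (D : {pred I}) (a : I -> M).
Hypothesis aB : is_basis (fun (c : K) (m : M) => c%:A *: m) D a.

Let support_in (f : I -> K) (r : seq I) :=
  [/\ uniq r, all [in D] r & forall k, k \notin r -> f k = 0].

Let support_sum f r r' : support_in f r -> uniq r' -> {subset r <= r'} ->
  \sum_(k <- r) (f k)%:A *: a k = \sum_(k <- r') (f k)%:A *: a k.
Proof.
move=> [ur _ f0] ur' sub; rewrite [RHS](bigID [in r]) /= [X in _ + X]big1 ?addr0; last first.
  by move=> k /f0 ->; rewrite !scale0r.
rewrite -[RHS]big_filter; apply: perm_big; apply: uniq_perm => //; first exact: filter_uniq.
by move=> k; rewrite mem_filter; case kr : (k \in r); rewrite // sub.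
Qed.

Let coordinates (m : M) (f : I -> K) :=
  exists2 r, support_in f r & m = \sum_(k <- r) (f k)%:A *: a k.

Let coordinates_ex m : exists f, coordinates m f.
Proof.
have [r [c [rD ->]]] := basis_span aB m.
(* The spanning list may repeat an index, in which case its coefficient is counted with
   multiplicity. *)
exists (fun k => c k *+ count_mem k r), (undup r); first split.
- exact: undup_uniq.
- by rewrite all_undup.
- by move=> k; rewrite mem_undup => /count_memPn ->; rewrite mulr0n.
rewrite -[LHS]big_undup_iterop_count; apply: eq_bigr => k _.
by rewrite -!scalerMnl.
Qed.

Definition basis_coord (m : M) : I -> K := projT1 (cid (coordinates_ex m)).

Let coordP m : coordinates m (basis_coord m).
Proof. by rewrite /basis_coord; case: cid. Qed.

Let coordinates_comb c m m' f f' : coordinates m f -> coordinates m' f' ->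
  coordinates (c%:A *: m + m') (fun k => c * f k + f' k).
Proof.
move=> [r [ur rD f0] ->] [r' [ur' rD' f0'] ->]; set q := undup (r ++ r').
have uq : uniq q by exact: undup_uniq.
have sr : {subset r <= q} by move=> k kr; rewrite mem_undup mem_cat kr.
have sr' : {subset r' <= q} by move=> k kr; rewrite mem_undup mem_cat kr orbT.
exists q; first split=> //.
- by rewrite all_undup all_cat rD.
- by move=> k; rewrite mem_undup mem_cat negb_or => /andP[/f0 -> /f0' ->]; rewrite mulr0 addr0.
rewrite (@support_sum f r q) // (@support_sum f' r' q) // scaler_sumr -big_split /=.
by apply: eq_bigr => k _; rewrite scalerA -scalerAl mul1r scalerA -!scalerDl.
Qed.

Let coordinates_inj m f f' : coordinates m f -> coordinates m f' -> f = f'.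
Proof.
move=> mf mf'; have [r [ur rD f0]] := coordinates_comb (-1) mf mf'.
rewrite !scaleN1r addNr => /esym sum0; apply/funext => k.
have {sum0} r0 := basis_indep aB ur rD sum0.
apply/eqP; rewrite -subr_eq0 -opprB oppr_eq0 addrC -mulN1r; apply/eqP.
by have [/r0|/f0] := boolP (k \in r).
Qed.

Lemma basis_coord_comb c m m' k : basis_coord (c%:A *: m + m') k = c * basis_coord m k + basis_coord m' k.
Proof.
by rewrite (coordinates_inj (coordP _) (coordinates_comb c (coordP m) (coordP m'))).
Qed.

Lemma basis_coord_basis x k : x \in D -> basis_coord (a x) k = (k == x)%:R.
Proof.
move=> xD; suff /(coordinates_inj (coordP (a x))) -> : coordinates (a x) (fun k => (k == x)%:R) by [].
exists [:: x]; first split; rewrite //= ?xD //.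
  by move=> j; rewrite inE => /negbTE ->.
by rewrite big_seq1 eqxx !scale1r.
Qed.

Lemma basis_coordD m m' k : basis_coord (m + m') k = basis_coord m k + basis_coord m' k.
Proof. by have := basis_coord_comb 1 m m' k; rewrite !scale1r mul1r. Qed.

Lemma basis_coord0 k : basis_coord 0 k = 0.
Proof. by apply: (addrI (basis_coord 0 k)); rewrite -basis_coordD !addr0. Qed.

Lemma basis_coordZ c m k : basis_coord (c%:A *: m) k = c * basis_coord m k.
Proof. by have := basis_coord_comb c m 0 k; rewrite basis_coord0 !addr0. Qed.

Lemma basis_comb_ind (Q : M -> Prop) : Q 0 ->
  (forall c m m', Q m -> Q m' -> Q (c%:A *: m + m')) -> {in D, forall x, Q (a x)} ->
  forall m, Q m.
Proof.
move=> Q0 Qcomb Qa m; have [r [c [rD ->]]] := basis_span aB m.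
elim: r rD => [|x r IH] /=; first by rewrite big_nil.
by case/andP=> xD rD; rewrite big_cons; apply: Qcomb; [apply: Qa | apply: IH].
Qed.
End Coordinates.

(** * The bar involution of [M] and its limit at [u = 0] *)

Section BarInvolution.
Variables (W : groupType) (S : {pred W}) (coxW : coxeter_system S).
Variables (star : {multiplicative W -> W}) (coxstar : coxeter_involution S star).
Variables (H : unitAlgType Zu) (T : W -> H) (heckeH : hecke_algebra S T).
Variables (barH : {rmorphism H -> H}) (barHP : hecke_bar T barH).
Variables (M : lmodType H) (a : W -> M) (invM : involution_module S star T a).
Variables (barM : {additive M -> M}) (barMP : involution_bar barH a barM).
Local Notation l := (cox_length S).
Local Notation tw := (twisted star).
Local Notation Istar := (Istar star).
Local Notation coord := (basis_coord (inv_basis invM)).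
Local Notation down s w := (l (s * w)%g < l w)%N.
Local Notation comm s w := (s * w == w * star s)%g.

Definition T_diag (s w : W) : Zu :=
  if down s w then (if comm s w then u ^+ 2 - u - 1 else u ^+ 2 - 1)
  else (if comm s w then u else 0).

(** Indexed by the target: this is the coefficient of [a w] in [T s *: a (twisted s w)], hence the
    descent cases are opposite to those of the module axioms. *)
Definition T_off (s w : W) : Zu :=
  if down s w then (if comm s w then u + 1 else 1)
  else (if comm s w then u ^+ 2 - u else u ^+ 2).

Lemma T_act s w : s \in S -> w \in Istar ->
  T s *: a w = (T_diag s w)%:A *: a w + (T_off s (tw s w))%:A *: a (tw s w).
Proof.
move=> sS wI; rewrite /T_diag /T_off (twisted_descent coxW coxstar) //.
rewrite (twisted_comm coxW coxstar) // /twisted.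
case: (boolP (down s w)) => [dn|up]; [have lt := bruhat_mul_down coxW sS dn|
  have lt := bruhat_mul_up coxW sS up]; case: eqP => [c|nc] /=.
- by rewrite (inv_comm_lt invM).
- by rewrite (inv_ncomm_lt invM).
- by rewrite (inv_comm_gt invM).
- by rewrite (inv_ncomm_gt invM) // !scale0r add0r !scale1r.
Qed.

Lemma coord_T s m y : s \in S -> y \in Istar ->
  coord (T s *: m) y = T_diag s y * coord m y + T_off s y * coord m (tw s y).
Proof.
move=> sS yI; elim/(basis_comb_ind (inv_basis invM)): m => [|c m m' IH IH'|x xI].
- by rewrite scaler0 !basis_coord0 !mulr0 addr0.
- rewrite scalerDr scalerA -scalerAr mulr1 -[c *: T s]mulr_algl -scalerA.
  by rewrite !basis_coord_comb IH IH' !mulrDr addrACA ![c * (_ * _)]mulrCA.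
rewrite T_act // basis_coord_comb basis_coordZ !basis_coord_basis // ?(twisted_Istar coxW coxstar) //.
rewrite (can2_eq (twistedK coxW coxstar sS) (twistedK coxW coxstar sS)).
by congr (_ + _); case: eqP => [->|]; rewrite ?mulr1 ?mulr0 // (twistedK coxW coxstar).
Qed.

Lemma lat0_T_diag s y : lat0 (T_diag s y) (- (down s y)%:R).
Proof.
have u0 : lat0 u 0 by exact: lat0_gen.
have u20 : lat0 (u ^+ 2) 0 by apply: (lat0X 2 u0).
rewrite /T_diag; case: ifP => _; case: ifP => _; rewrite ?oppr0 //; last exact: lat00.
- exact: (lat0B (lat0B u20 u0) (lat01 _)).
- exact: (lat0B u20 (lat01 _)).
Qed.

Lemma lat0_T_off s y : lat0 (T_off s y) (down s y)%:R.
Proof.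
have u0 : lat0 u 0 by exact: lat0_gen.
have u20 : lat0 (u ^+ 2) 0 by apply: (lat0X 2 u0).
rewrite /T_off; case: ifP => _; case: ifP => _ //.
- exact: (lat0D u0 (lat01 _)).
- exact: lat01.
- exact: (lat0B u20 u0).
Qed.

Lemma hecke_mulT s : s \in S -> T s * (T s + 1 - (u ^+ 2)%:A) = (u ^+ 2)%:A.
Proof.
move=> sS; apply/subr0_eq; rewrite -[RHS](hecke_quad heckeH sS).
by rewrite mulrBr mulrDr mulr1 mulrDl mul1r mulrBr addrA [_ + T s - _]addrAC.
Qed.

Lemma hecke_Tmul s : s \in S -> (T s + 1 - (u ^+ 2)%:A) * T s = (u ^+ 2)%:A.
Proof.
move=> sS; rewrite -[RHS](hecke_mulT sS) mulrBl mulrBr mulr_algl mulr_algr.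
by rewrite mulrDl mulrDr mul1r mulr1.
Qed.

Lemma hecke_T_unit s : s \in S -> T s \is a GRing.unit.
Proof.
move=> sS; have u2 : u ^+ 2 \is a GRing.unit by rewrite unitrX // laurent_gen_unit.
apply/unitrP; exists ((u ^+ 2)^-1 *: (T s + 1 - (u ^+ 2)%:A)).
by rewrite -scalerAl -scalerAr hecke_mulT // hecke_Tmul // scalerA mulVr // scale1r.
Qed.

(** [barH] sends [T s] to its inverse, and by the quadratic relation [u ^+ 2] times that inverse is
    [T s + 1 - u ^+ 2]. *)
Lemma barM_T s m : s \in S ->
  (u ^+ 2)%:A *: barM (T s *: m) = T s *: barM m + (1 - u ^+ 2)%:A *: barM m.
Proof.
move=> sS; have := hecke_barE barHP 0 s.
rewrite (cox_invg coxW sS) oppr0 expr0z !scale1r (inv_barZ barMP) => ->.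
rewrite scalerA -[X in X / _](hecke_Tmul sS) mulrK ?hecke_T_unit //.
have -> : (1 - u ^+ 2)%:A = 1 - (u ^+ 2)%:A :> H by rewrite scalerBl scale1r.
by rewrite -addrA scalerDl.
Qed.

Lemma barH_scalar n : barH (u ^ n)%:A = (u ^ (- n))%:A.
Proof.
have := hecke_barE barHP n 1%g.
by rewrite invg1 (hecke_T1 heckeH) invr1.
Qed.

Definition bar_coef (w y : W) : Zu := u ^+ l w * coord (barM (a w)) y.

(** Obtained by applying [barM] to the expansion of [T s *: a (tw s w)]. The length drops by 1 or 2
    from [w] to [tw s w], which absorbs exactly the power of [u] left over on the side of [w]. *)
Lemma bar_coef_twisted s w y : s \in S -> w \in Istar -> y \in Istar -> down s w ->
  (if comm s w then 1 + u else 1) * bar_coef w y =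
  (T_diag s y + 1 - u ^+ 2 - (if comm s w then u else 0)) * bar_coef (tw s w) y
  + T_off s y * bar_coef (tw s w) (tw s y).
Proof.
move=> sS wI yI dn; set w1 := tw s w.
have w1I : w1 \in Istar by exact: (twisted_Istar coxW coxstar).
have := congr1 (fun m => coord m y) (barM_T (a w1) sS).
rewrite basis_coordD !basis_coordZ coord_T // T_act // /w1 (twistedK coxW coxstar) // -/w1.
rewrite /T_diag (twisted_descent coxW coxstar) // (twisted_comm coxW coxstar) //.
rewrite [X in X%:A *: a w]/T_off dn /= /bar_coef.
rewrite [l w](twisted_length coxW coxstar sS wI dn) -/w1.
rewrite -/(T_diag s y); set td := T_diag s y; set to := T_off s y.
have uV : u * u^-1 = 1 by rewrite mulrV // laurent_gen_unit.
have barHu : barH u%:A = (u^-1)%:A by have := barH_scalar 1; rewrite expr1z exprN1.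
have barHu1 : barH (u + 1)%:A = (u^-1 + 1)%:A.
  by rewrite !scalerDl !scale1r rmorphD rmorph1 barHu.
case: eqP => _; rewrite raddfD /= !(inv_barZ barMP) basis_coordD exprD; move: uV.
  rewrite barHu barHu1 !basis_coordZ expr1.
  (* Once [u^-1] is generalised to [z], only [u * z = 1] ties it to [u], and a polynomial identity
     remains. *)
  move: (u^-1) (u ^+ l w1) (coord _ y) (coord _ y) (coord _ (tw s y)) => z q c c1 c1' uz E.
  have e : u ^+ 2 * (z * c1 + (z + 1) * c) = (u * z) * (u * c1 + u * c) + u ^+ 2 * c by ring.
  rewrite e uz in E; transitivity (q * (1 * (u * c1 + u * c) + u ^+ 2 * c - u * c1)); first by ring.
  by rewrite E; ring.
rewrite scale0r !scale1r rmorph0 rmorph1 !scale0r !scale1r basis_coord0 add0r => _ E.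
rewrite mul1r -mulrA E; ring.
Qed.

(* As [v -> 0], [u ^+ l w *: barM (a w)] tends to the sum of the [a y], y <= w. *)
Lemma lat0_bar_coef w y : w \in Istar -> y \in Istar ->
  lat0 ((bar_coef w y)) `[< bruhat S y w >]%:R.
Proof.
have [n] := ubnP (l w); elim: n w y => // n IH w y /ltnSE lw wI yI.
have [->|/eqP w1] := eqVneq w 1%g.
  rewrite /bar_coef (cox_length1 coxW) expr0 mul1r (inv_bar1 barMP).
  rewrite basis_coord_basis ?Istar1 // (_ : `[< _ >] = (y == 1%g)); last first.
    by apply/asboolP/eqP => [/(bruhat1 coxW)|->] //; apply: bruhat_refl.
  by case: eqP => _; [apply: lat01 | apply: lat00].
have [s sS dn] := left_descent_ex coxW w1.
have lw1 : (l (tw s w) < n)%N.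
  apply: leq_trans lw; rewrite [in X in (_ < X)%N](twisted_length coxW coxstar sS wI dn).
  by rewrite -addn1 leq_add2l; case: ifP.
have w1I := twisted_Istar coxW coxstar sS wI.
have y1I := twisted_Istar coxW coxstar sS yI.
have E1 := IH _ _ lw1 w1I yI; have E2 := IH _ _ lw1 w1I y1I.
have u0 : lat0 u 0 by exact: lat0_gen.
have u20 : lat0 (u ^+ 2) 0 by apply: (lat0X 2 u0).
have one := lat01 2.
have /lat0_cancel : lat0 (if comm s w then 1 + u else 1) 1.
  by case: ifP => _ //; apply: (lat0D one u0).
apply; rewrite bar_coef_twisted //.
have cu : lat0 (if comm s w then u else 0) 0.
  by case: ifP => _ //; apply: lat00.
(* At 0 the coefficients of the two summands are 0 and 1 if [s] is a left descent of [y], and 1 and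
   0 otherwise. The sum therefore picks the lower of [y] and [tw s y], as in [bruhat_twistedE]. *)
have := lat0D (lat0M (lat0B (lat0B (lat0D (lat0_T_diag s y) one) u20) cu) E1)
              (lat0M (lat0_T_off s y) E2).
congr lat0.
rewrite (asbool_equiv_eq (bruhat_twistedE coxW coxstar sS yI wI dn)).
by case: ifP => _; rewrite ?mul1r ?mul0r ?subr0 ?addr0 ?oppr0 ?addNr ?mul0r ?add0r ?mul1r.
Qed.
End BarInvolution.

(** * Coordinate functionals on the scalar extension *)

Lemma Zu_ZvD x y : Zu_Zv (x + y) = Zu_Zv x + Zu_Zv y.
Proof. by apply/val_inj; rewrite [RHS]rmorphD; exact: (rmorphD val x y). Qed.

Lemma Zu_ZvM x y : Zu_Zv (x * y) = Zu_Zv x * Zu_Zv y.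
Proof. by apply/val_inj; rewrite [RHS]rmorphM; exact: (rmorphM val x y). Qed.

Section ScalarExtension.
Variables (H : unitAlgType Zu) (M : lmodType H) (W : choiceType) (D : {pred W}).
Variables (a : W -> M) (aB : is_basis (fun (c : Zu) (m : M) => c%:A *: m) D a).
Variables (vM : lmodType Zv) (iota : {additive M -> vM}).

Definition Zv_coord (y : W) (m : M) : Zv^o := Zu_Zv (basis_coord aB m y).

Fact Zv_coord_is_zmod_morphism y : zmod_morphism (Zv_coord y).
Proof.
move=> m m'; rewrite -[m in RHS](subrK m').
by rewrite {2}/Zv_coord basis_coordD Zu_ZvD addrK.
Qed.

HB.instance Definition _ y := GRing.isZmodMorphism.Build M Zv^o (Zv_coord y)
  (Zv_coord_is_zmod_morphism y).

(** The coordinate at [y] is semilinear along [Zu_Zv], so it factors through [iota]. The resulting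
    functional reads off coefficients in [vM] directly from the universal property. *)
Lemma scalar_extension_coord y : scalar_extension iota ->
  exists g : {linear vM -> Zv^o}, forall m, g (iota m) = Zu_Zv (basis_coord aB m y).
Proof.
move=> ext; have [c m|g [gE _]] := ext_universal ext (f := Zv_coord y).
  by rewrite /= /Zv_coord basis_coordZ Zu_ZvM.
by exists g.
Qed.
End ScalarExtension.

(** * Comparison of the coefficients of [a y] in the bar-invariance of [KL_elt] *)

Theorem proposition4p10
  (W : groupType) (S : {pred W}) (coxW : coxeter_system S)
  (star : {multiplicative W -> W}) (coxstar : coxeter_involution S star)
  (H : unitAlgType Zu) (T : W -> H) (heckeH : hecke_algebra S T)
  (barH : {rmorphism H -> H}) (barHP : hecke_bar T barH)
  (M : lmodType H) (a : W -> M) (invM : involution_module S star T a)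
  (barM : {additive M -> M}) (barMP : involution_bar barH a barM)
  (vM : lmodType Zv) (iota : {additive M -> vM})
  (extM : scalar_extension iota)
  (barvM : {additive vM -> vM}) (barvMP : extended_bar iota barM barvM)
  (P : W -> W -> {poly int}) (KLP : KL_polynomials S star iota a barvM P)
  (y w : W) (yI : y \in Istar star) (wI : w \in Istar star)
  (yw : bruhat S y w) :
  (P y w)`_0 = 1.
Proof.
pose l := cox_length S.
pose D := [set x | x \in Istar star /\ bruhat S x w]%classic.
(* Finiteness turns the sum in [KL_elt], which would default to 0 on an infinite support, into a sum
   over the list [r]. *)
have finD : finite_set D.
  by apply: sub_finite_set (finite_bruhat coxW w) => x [].
pose r := finmap.enum_fset (fset_set D).
have memr x : x \in r = `[< x \in Istar star /\ bruhat S x w >].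
  by rewrite in_fset_set // in_setE.
have rP x : x \in r -> x \in Istar star /\ bruhat S x w by rewrite memr => /asboolP.
have [yr wr] : y \in r /\ w \in r.
  by rewrite !memr; split; apply/asboolP; split=> //; apply: bruhat_refl.
have ur : uniq r by exact: finmap.fset_uniq.
have [g gE] := scalar_extension_coord (inv_basis invM) y extM.
pose c x := Zu_Zv (basis_coord (inv_basis invM) (barM (a x)) y).
have v_unit : v \is a GRing.unit by exact: laurent_gen_unit.
(* Expansion into monomials [v ^ n *: iota m], the only elements on which [extended_bar] prescribes
   the bar map. *)
have KLE : KL_elt S star iota a P w = \sum_(x <- r) \sum_(i < size (P x w))
    ((P x w)`_i)%:~R *: (v ^ ((2 * i)%:Z - (l w)%:Z) *: iota (a x)).
  rewrite /KL_elt fsbig_finite //= scaler_sumr; apply: eq_bigr => x _.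
  rewrite horner_poly scaler_suml scaler_sumr; apply: eq_bigr => i _.
  rewrite Zu_Zv_u !scalerA mulrCA; congr (_ * _ *: _).
  by rewrite addrC exprzDr // -exprnP exprM.
have KL_coord : g (KL_elt S star iota a P w) =
    v ^ (- (l w)%:Z) * (map_poly intr (P y w)).[Zu_Zv u].
  rewrite /KL_elt fsbig_finite //= linearZ raddf_sum /=; congr (_ * _).
  rewrite (bigD1_seq y) //= big1_seq ?addr0 => [|x /andP[xy xr]].
    rewrite linearZ gE basis_coord_basis // eqxx (_ : Zu_Zv true%:R = 1); last exact/val_inj.
    exact: mulr1.
  rewrite linearZ gE basis_coord_basis; last by case: (rP _ xr).
  rewrite eq_sym (negbTE xy) (_ : Zu_Zv false%:R = 0); last exact/val_inj.
  exact: mulr0.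
have bar_coord : g (barvM (KL_elt S star iota a P w)) =
    \sum_(x <- r) \sum_(i < size (P x w))
      ((P x w)`_i)%:~R * (v ^ ((l w)%:Z - (2 * i)%:Z) * c x).
  rewrite KLE raddf_sum raddf_sum; apply: eq_bigr => x _.
  rewrite raddf_sum raddf_sum; apply: eq_bigr => i _ /=.
  by rewrite scaler_int raddfMz raddfMz barvMP /= linearZ gE opprB mulrzl.
have pE : (map_poly intr (P y w)).[Zu_Zv u] =
    \sum_(x <- r) \sum_(i < size (P x w))
      ((P x w)`_i)%:~R * (v ^ ((2 * l w)%:Z - (2 * i)%:Z) * c x).
  have := congr1 (fun m => v ^ (l w)%:Z * g m) (KL_bar KLP wI).
  rewrite bar_coord KL_coord mulrA -exprzDr // subrr expr0z mul1r => <-.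
  rewrite mulr_sumr; apply: eq_bigr => x _; rewrite mulr_sumr; apply: eq_bigr => i _.
  rewrite mulrCA; congr (_ * _); rewrite mulrA -exprzDr //; congr (v ^ _ * _); lia.
have cP x : x \in r -> lat0 (v ^+ (2 * l x) * c x) `[< bruhat S y x >]%:R.
  move=> /rP[xI _].
  (* [Zu_Zv] keeps the underlying fraction, so the limit found over [Zu] holds over [Zv] by
     conversion. *)
  have : lat0 (Zu_Zv _) _ := lat0_bar_coef coxW coxstar heckeH barHP invM barMP xI yI.
  rewrite Zu_ZvM (_ : Zu_Zv (u ^+ l x) = v ^+ (2 * l x)) //.
  by apply/val_inj; rewrite exprM -Zu_Zv_u [RHS]rmorphXn; exact: (rmorphXn val _ u).
have v0 : lat0 v 0 by exact: lat0_gen.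
have p0 : lat0 (map_poly intr (P y w)).[Zu_Zv u] (P y w)`_0.
  rewrite horner_poly Zu_Zv_u -[X in lat0 _ X]horner_coef0 horner_coef.
  apply: lat0_sum => i _ _; apply: lat0M; first exact: lat0_int.
  exact: lat0X (lat0X 2 v0).
(* The term at [w] has limit 1 because [P w w = 1] and [y] lies below [w]; every other term tends to
   0. *)
apply: lat0_inj p0 _; rewrite pE (bigD1_seq w) //= -[X in lat0 _ X]addr0; apply: lat0D.
  rewrite (KL_diag KLP wI) size_poly1 big_ord1 coef1 /= mul1r muln0 subr0.
  by have := cP w wr; rewrite asboolT.
have zE : \sum_(x <- r | x != w) \sum_(i < size (P x w)) 0 = 0 :> int.
  by rewrite big1 // => x _; rewrite big1.
rewrite -[X in lat0 _ X]zE; apply: lat0_sum => x xr xw; apply: lat0_sum => i _ _.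
have [xI xw'] := rP _ xr.
have deg := KL_deg KLP xI wI (conj xw' (elimN eqP xw)).
(* The degree bound gives [2 * i + l x < l w], so a positive power of [v] remains after
   [v ^+ (2 * l x)] is spent on making [c x] regular. *)
have [n nE] : exists n, (2 * l w = n.+1 + 2 * l x + 2 * i)%N.
  exists (2 * l w - 2 * l x - 2 * i).-1; have := ltn_ord i.
  move: deg; rewrite -/(l x) -/(l w) -muln2.
  by move: (l x) (l w) (size _) (nat_of_ord i) => lx lw sz j; lia.
rewrite nE PoszD addrK PoszD exprzDr // -mulrA.
have := lat0M (lat0_int _ (P x w)`_i) (lat0M (lat0X n.+1 v0) (cP x xr)).
by rewrite expr0n mul0r mulr0.
Qed.
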